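(* Suppose that $h$ is steep and that $f$ is $\mu$-strongly convex and $L$-smooth, both relative to $h$, with minimizer $x^*$ over $\mathcal X$, and that $\sigma>0$. There exist constants $a,C>0$, depending only on $p,\mu,L,K,H$ and $\|\mathcal X\|$, and a threshold $\varepsilon_0\in(0,1)$ (which may also depend on $\sigma$), such that for every target accuracy $\varepsilon\in(0,\varepsilon_0]$: if (SDA) is run with $y_1=0$ and constant learning rate $\eta=a\,(\varepsilon/\sigma^p)^{1/(p-1)}$, then $$\mathbb E\big[\|x_t-x^*\|^2\big]\le\varepsilon\qquad\text{for all } t\ge C\,(\sigma^p/\varepsilon)^{1/(p-1)}\log(1/\varepsilon).$$
   Context: Optimization setup. $\mathcal V$ is a real $n$-dimensional normed space with norm $\|\cdot\|$; $\mathcal Y=\mathcal V^*$ is its dual, with pairing $\langle y,x\rangle$ and dual norm $\|y\|_*=\sup\{\langle y,x\rangle:\|x\|\le1\}$. $\mathcal X\subset\mathcal V$ is a nonempty compact convex set with diameter $\|\mathcal X\|=\max_{x,x'\in\mathcal X}\|x'-x\|$. The objective $f:\mathcal V\to\mathbb R\cup\{\infty\}$ is convex, finite and continuous on $\mathcal X$, and $\partial f$ admits a continuous selection $\nabla f(x)\in\partial f(x)$ on $\operatorname{dom}\partial f=\{x:\partial f(x)\ne\varnothing\}$. Mirror setup. $h:\mathcal V\to\mathbb R\cup\{\infty\}$ is convex with $\operatorname{dom}h=\mathcal X$, continuous on $\mathcal X$; $\mathcal X_h=\operatorname{dom}\partial h$; $\partial h$ admits a continuous selection $\nabla h$ on $\mathcal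 X_h$; and for some $K>0$, $h(x')\ge h(x)+\langle\nabla h(x),x'-x\rangle+\frac K2\|x'-x\|^2$ for all $x\in\mathcal X_h$, $x'\in\mathcal X$. $h$ is steep if $\mathcal X_h$ equals the relative interior of $\mathcal X$. It is assumed that $\nabla f$ is defined on $\mathcal X_h$. $D(x',x)=h(x')-h(x)-\langle\nabla h(x),x'-x\rangle$ is the Bregman divergence, $Q(y)=\operatorname{argmax}_{x\in\mathcal X}\{\langle y,x\rangle-h(x)\}$ the mirror map, and $H=\max_{\mathcal X}h-\min_{\mathcal X}h$. $f$ is $L$-smooth (resp. $\mu$-strongly convex, $\mu>0$) relative to $h$ if $f(x')\le f(x)+\langle\nabla f(x),x'-x\rangle+L\,D(x',x)$ (resp. $f(x')\ge f(x)+\langle\nabla f(x),x'-x\rangle+\mu D(x',x)$) for all $x\in\mathcal X_h$, $x'\in\mathcal X$. Algorithm. (SDA): $y_{t+1}=y_t-g_t$, $x_{t+1}=Q(\eta_{t+1}y_{t+1})$, $t=1,2,\dots$, with $x_1=Q(\eta_1y_1)$ and stochastic gradients $g_t=\nabla f(x_t)+U_t$, $U_t=U(x_t;\omega_t)$, where $\omega_1,\omega_2,\dots$ are i.i.d. random seeds and, for all $x\in\operatorname{dom}\partial f$, $\mathbb E[U(x;\omega)]=0$ and $\mathbb E[\|U(x;\omega)\|_*^p]\le\sigma^p$ for some $p\in(1,2]$. *)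

(* Defs.v *)
From HB Require Import structures.
From mathcomp Require Import all_boot all_order all_algebra.
From mathcomp Require Import all_classical all_reals all_analysis.
Import Order.TTheory GRing.Theory Num.Theory.
Import numFieldNormedType.Exports.

Set Implicit Arguments.
Unset Strict Implicit.
Unset Printing Implicit Defensive.

Local Open Scope classical_set_scope.
Local Open Scope ring_scope.

(* V is finite-dimensional wherever the definitions below are used, so that its
   dual is the type {linear V -> R^o} of all linear forms. *)

Section Geometry.
Context (R : realType) (V : normedModType R).
Implicit Types (A X : set V) (y : V -> R) (x v : V).

(* In finite dimension the set below is bounded, so the real sup is not the
   default value of an unbounded set. *)
Definition dual_norm y : R := sup [set y x | x in [set x | `|x| <= 1]].

(* Used on nonempty compact sets only, on which the sup is a maximum. *)
Definition diameter X : R :=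
  sup [set r | exists x x', [/\ X x, X x' & r = `|x' - x|]].

Definition affine_hull A : set V :=
  [set v | exists (m : nat) (c : 'I_m -> R) (a : 'I_m -> V),
     [/\ forall i, A (a i), \sum_(i < m) c i = 1
       & v = \sum_(i < m) c i *: a i]].

(* Interior relative to the affine hull. *)
Definition relint A : set V :=
  [set x | A x /\ within (affine_hull A) (nbhs x) A].

(* Continuity on D, in the dual norm, of a map defined on D; values outside D
   are junk. *)
Definition dual_continuous_on (D : set V) (g : V -> {linear V -> R^o}) :=
  forall x, D x -> dual_norm (g x' \- g x) @[x' --> within D (nbhs x)] --> 0.

End Geometry.

Section ConvexAnalysis.
Context (R : realType) (V : normedModType R).
Implicit Types (f h : V -> \bar R) (X : set V) (g gh gf : V -> {linear V -> R^o}).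

Local Open Scope ereal_scope.

(* Functions V -> R u {+oo}; with 0 * +oo = 0 the cases t = 0, 1 are trivial. *)
Definition econvex f :=
  (forall x, f x != -oo) /\
  forall (x x' : V) (t : R), (0 <= t <= 1)%R ->
    f (t *: x + (1 - t) *: x')%R <= t%:E * f x + (1 - t)%:E * f x'.

Definition edom f : set V := [set x | f x < +oo].

(* For f with nonempty domain, this is empty at points where f x = +oo. *)
Definition subdiff f (x : V) : set {linear V -> R^o} :=
  [set y | forall x', f x + (y (x' - x)%R)%:E <= f x'].

Definition dom_subdiff f : set V := [set x | subdiff f x !=set0].

Definition continuous_selection f g :=
  (forall x, dom_subdiff f x -> subdiff f x (g x)) /\
  dual_continuous_on (dom_subdiff f) g.

Definition objective X f gf :=
  [/\ econvex f, forall x, X x -> f x \is a fin_num,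
      {within X, continuous f} & continuous_selection f gf].

(* h is finite exactly on X, and K-strongly convex with respect to the norm. *)
Definition regularizer X (K : R) h gh :=
  [/\ econvex h, edom h = X, {within X, continuous h},
      continuous_selection h gh
    & forall x x', dom_subdiff h x -> X x' ->
        h x + (gh x (x' - x)%R)%:E + (K / 2 * `|x' - x| ^+ 2)%:E <= h x'].

Definition steep X h := dom_subdiff h = relint X.

Definition bregman h gh (x' x : V) : \bar R :=
  h x' - h x - (gh x (x' - x)%R)%:E.

Definition rel_smooth X h gh f gf (L : R) :=
  forall x x', dom_subdiff h x -> X x' ->
    f x' <= f x + (gf x (x' - x)%R)%:E + L%:E * bregman h gh x' x.

Definition rel_strongly_convex X h gh f gf (mu : R) :=
  forall x x', dom_subdiff h x -> X x' ->
    f x + (gf x (x' - x)%R)%:E + mu%:E * bregman h gh x' x <= f x'.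

Definition minimizer X f (xs : V) := X xs /\ forall x, X x -> f xs <= f x.

(* max_X h - min_X h: h is finite on X, and the extrema are attained when h is
   continuous on the nonempty compact set X. *)
Definition range_width X h : R :=
  (sup [set fine (h x) | x in X] - inf [set fine (h x) | x in X])%R.

(* The argmax set Q(y); it is a singleton for a regularizer on a nonempty
   compact convex X, so that x \in Q(y) says x = Q(y). *)
Definition mirror X h (y : V -> R) : set V :=
  [set x | X x /\ forall x', X x' -> (y x')%:E - h x' <= (y x)%:E - h x].

End ConvexAnalysis.

Section Stochastic.
Context (R : realType) (V : normedModType R).
Context (d : measure_display) (Om : measurableType d) (P : probability Om R).
Context (dS : measure_display) (S : measurableType dS).
Implicit Types (U : V -> S -> {linear V -> R^o}) (seed : nat -> Om -> S).

Definition borel := g_sigma_algebraType (@open V).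

(* Sequences are indexed by t >= 1; their values at 0 are never used. *)
Definition iid seed :=
  [/\ forall t, (0 < t)%N -> measurable_fun setT (seed t),
      forall t (B : set S), (0 < t)%N -> measurable B ->
        P (seed t @^-1` B) = P (seed 1%N @^-1` B)
    & forall (I : seq nat) (B : nat -> set S), uniq I ->
        (forall t, t \in I -> (0 < t)%N /\ measurable (B t)) ->
        P (\bigcap_(t in [set` I]) (seed t @^-1` B t)) =
        (\prod_(t <- I) P (seed t @^-1` B t))%E].

(* D is the domain of the oracle and D0 a Borel subset of D containing the
   query points, on which the noise is jointly measurable. A random linear form
   is measurable, resp. centered, when its values at all vectors are. *)
Definition stochastic_noise (D0 D : set V) U seed (p sigma : R) :=
  [/\ forall v : V, measurable_fun ((D0 : set borel) `*` [set: S])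
        (fun z : (borel * S)%type => (U z.1 z.2 v : R)),
      forall x v, D x -> measurable_fun [set: S] (fun s => (U x s v : R)),
      forall x v, D x -> ('E_P[fun w => U x (seed 1%N w) v] = 0)%E
    & forall x, D x ->
        ('E_P[fun w => (dual_norm (U x (seed 1%N w)) `^ p)%R] <= (sigma `^ p)%:E)%E].

Definition sda (X : set V) (h : V -> \bar R) (gf : V -> {linear V -> R^o}) U
    seed (eta : nat -> R) (y : nat -> Om -> {linear V -> R^o})
    (x : nat -> Om -> V) :=
  forall t w, (0 < t)%N ->
    mirror X h (eta t \*: y t w) (x t w) /\
    y t.+1 w =1 y t w \- (gf (x t w) \+ U (x t w) (seed t w)).

End Stochastic.

(* Main.v *)
(* Steepness forces [h] to be differentiable along [X] on the relative interior,
   so dual averaging is mirror descent: [eta y_t] and [gh x_t] agree on [X - x_t].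
   With [D_t] the Bregman divergence from [x_t] to the minimizer, relative
   smoothness and strong convexity then give the pathwise recursion
     [D_(t+1) <= (1 - eta mu) D_t + eta <U_t, xs - x_t> + c (eta |U_t|)^p],
   since [u delta - K/4 delta^2 <= c u^p] for [delta] at most the diameter of [X].
   The query [x_t] depends on the seeds before [t] only, so by Fubini the linear
   noise term has mean zero and [E |U_t|^p <= sigma^p]; summing the geometric
   series leaves [E D_t <= (1 - eta mu)^(t-1) H + c eta^(p-1) sigma^p / mu], and
   [eta^(p-1) sigma^p] is a multiple of [eps]. *)

Require Import Defs.
From HB Require Import structures.
From mathcomp Require Import all_boot all_order all_algebra.
From mathcomp Require Import all_classical all_reals all_analysis.
From mathcomp Require Import measurable_realfun ring lra.
Import Order.TTheory GRing.Theory Num.Theory.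
Import numFieldNormedType.Exports.

Set Implicit Arguments.
Unset Strict Implicit.
Unset Printing Implicit Defensive.

Local Open Scope classical_set_scope.
Local Open Scope ring_scope.

(** * Coordinates in a finite-dimensional normed space *)

Section FiniteDimension.
Context (R : realType) (V : normedModType R).

(* The coordinate functions are bounded since the norm is bounded below on the
   compact unit sphere of the coordinate space. *)
Lemma exists_bounded_coordinates n : Vector.axiom n V ->
  exists (e : 'I_n -> V) (c : 'I_n -> V -> R) (M : R),
    [/\ 0 < M, forall v, v = \sum_i c i v *: e i,
        forall i, linear (c i : V -> R^o) & forall i v, `|c i v| <= M * `|v|].
Proof.
move=> [v2r lin_v2r [r2v v2rK r2vK]].
have lin_r2v : linear r2v.
  by move=> a u v; apply: (can_inj v2rK); rewrite lin_v2r !r2vK.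
pose L : {linear V -> 'rV_n} := HB.pack v2r (GRing.isLinear.Build _ _ _ _ v2r lin_v2r).
pose L' : {linear 'rV_n -> V} := HB.pack r2v (GRing.isLinear.Build _ _ _ _ r2v lin_r2v).
have r2vL : r2v =1 L' by [].
have v2rL : v2r =1 L by [].
pose e i := r2v (delta_mx 0 i).
pose c i v : R := v2r v 0 i.
have r2vE (u : 'rV[R]_n) : r2v u = \sum_i u 0 i *: e i.
  rewrite [in LHS](row_sum_delta u) r2vL linear_sum.
  by apply: eq_bigr => i _; rewrite linearZ.
have cont_r2v : continuous r2v.
  have -> : r2v = fun u : 'rV[R]_n => \sum_i u 0 i *: e i by exact/funext.
  apply: continuous_big => [|i _ u]; first exact: add_continuous.
  apply: cvgZr_tmp; last exact: coord_continuous.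
  exact: (@nbhs_filter 'rV[R]_n).
have [M M0 bnd] : exists2 M, 0 < M & forall v, `|v2r v| <= M * `|v|.
  pose A := [set u : 'rV[R]_n | `|u| = 1].
  have norm_cont (u : 'rV[R]_n) : `|u'| @[u' --> u] --> `|u| by exact: norm_continuous.
  have cA : compact A.
    apply: bounded_closed_compact.
      by exists 1; split => // r r1 u /= ->; exact: ltW.
    have -> : A = Num.Def.normr @^-1` [set 1 : R] by [].
    by apply: preimage_closed => [u _|]; [exact: norm_cont|exact: closed_eq].
  (* The sphere is empty only in dimension zero: a nonzero coordinate vector could be normalized.
     All coordinates then vanish and the bound 1 serves. *)
  have [A0|/set0P/negP] := pselect (A !=set0); last first.
    rewrite negbK => /eqP A0; exists 1 => // v; rewrite mul1r.
    have [->|v0] := eqVneq (v2r v) 0; first by rewrite normr0.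
    suff : A (`|v2r v|^-1 *: v2r v) by rewrite A0.
    by rewrite /A /= normrZ normfV normr_id mulVf// normr_eq0.
  have cg : {within A, continuous (fun u => `|r2v u|)}.
    apply: continuous_subspaceT => u.
    apply: cvg_norm; last exact: cont_r2v.
    exact: (@nbhs_filter 'rV[R]_n).
  have [u0 /set_mem u01 u0min] := compact_EVT_min A0 cA cg.
  have m0 : 0 < `|r2v u0|.
    rewrite normr_gt0; apply: contra_eqN u01 => /eqP u00.
    have -> : u0 = 0 by rewrite -[u0]r2vK u00 v2rL linear0.
    by rewrite normr0 eq_sym oner_eq0.
  (* The bound is the inverse of the least norm on the sphere; homogeneity carries it to every
     vector. *)
  exists `|r2v u0|^-1; first by rewrite invr_gt0.
  move=> v; rewrite ler_pdivlMl//.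
  have [->|v0] := eqVneq (v2r v) 0; first by rewrite normr0 mulr0.
  have nv0 : 0 < `|v2r v| by rewrite normr_gt0.
  have /u0min : `|v2r v|^-1 *: v2r v \in A.
    by rewrite inE /A /= normrZ normfV normr_id mulVf// gt_eqF.
  rewrite [r2v (_ *: _)]r2vL linearZ /= v2rK normrZ normfV normr_id.
  by rewrite mulrC ler_pdivlMr// mulrC.
exists e, c, M; split => //.
- by move=> v; rewrite -r2vE v2rK.
- by move=> i a u v; rewrite /c lin_v2r !mxE.
- move=> i v; apply: le_trans (bnd v); rewrite /c /Num.Def.normr /= mx_normrE.
  by apply: (le_bigmax _ (fun ij : 'I_1 * 'I_n => `|v2r v ij.1 ij.2|) (0, i)).
Qed.

End FiniteDimension.

(** * The dual norm of linear forms *)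

Section DualNorm.
Context (R : realType) (V : normedModType R) (n : nat).
Hypothesis Vdim : Vector.axiom n V.
Implicit Types y z : {linear V -> R^o}.

Lemma linear_form_bounded y : exists2 B, 0 <= B & forall v, `|y v| <= B * `|v|.
Proof.
have [e [c [M [M0 vE _ cM]]]] := exists_bounded_coordinates Vdim.
exists (M * \sum_i `|y (e i)|) => [|v].
  by rewrite mulr_ge0 ?sumr_ge0// ltW.
rewrite {1}(vE v) linear_sum (le_trans (ler_norm_sum _ _ _))//.
rewrite mulrAC mulr_sumr ler_sum// => i _.
by rewrite linearZ /= normrM ler_wpM2r.
Qed.

Lemma linear_form_continuous y : continuous y.
Proof.
have [B B0 yB] := linear_form_bounded y.
by apply: bounded_linear_continuous; apply/bounded_funP => r; exists (B * r) => v vr;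
  rewrite (le_trans (yB v))// ler_wpM2l.
Qed.

(** Rules out the default value of [sup], so that [dual_norm] is the genuine dual norm. *)
Lemma dual_norm_has_ubound y : has_ubound [set y x | x in [set x | `|x| <= 1]].
Proof.
have [B B0 yB] := linear_form_bounded y.
exists B => _ [x /= x1 <-]; rewrite (le_trans (ler_norm _))// (le_trans (yB x))//.
by rewrite ler_piMr.
Qed.

Lemma dual_norm_ge0 y : 0 <= dual_norm y.
Proof.
apply: ub_le_sup; first exact: dual_norm_has_ubound.
by exists 0; rewrite /= ?normr0 ?linear0.
Qed.

Lemma dual_norm_bound y v : `|y v| <= dual_norm y * `|v|.
Proof.
have [->|v0] := eqVneq v 0; first by rewrite linear0 !normr0 mulr0.
have nv0 : 0 < `|v| by rewrite normr_gt0.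
have le1 w : `|w| <= 1 -> y w <= dual_norm y.
  by move=> w1; apply: ub_le_sup; [exact: dual_norm_has_ubound|exists w].
have n1 : `| `|v|^-1 *: v| <= 1 by rewrite normrZ normfV normr_id mulVf// gt_eqF.
rewrite -ler_pdivrMr// mulrC.
case: (lerP 0 (y v)) => [y0|y0].
  by rewrite ger0_norm//; have := le1 _ n1; rewrite linearZ.
rewrite ltr0_norm//; have := le1 (- (`|v|^-1 *: v)).
by rewrite normrN n1 => /(_ isT); rewrite linearN linearZ /= -mulrN.
Qed.

Lemma dual_norm_le y B : (forall v, `|v| <= 1 -> y v <= B) -> dual_norm y <= B.
Proof.
move=> yB; apply: ge_sup; first by exists (y 0); exists 0 => //=; rewrite normr0.
by move=> _ [v v1 <-]; exact: yB.
Qed.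

(** Reduces questions about the dual norm to finitely many real values [y (e i)]; the measurability
    proofs below rest on this. *)
Lemma dual_norm_coordinates : exists (e : 'I_n -> V) (c : 'I_n -> V -> R) (M : R),
  [/\ 0 < M, forall v, v = \sum_i c i v *: e i,
      forall i, continuous (c i)
    & forall y, dual_norm y <= M * \sum_i `|y (e i)|].
Proof.
have [e [c [M [M0 vE lc cM]]]] := exists_bounded_coordinates Vdim.
exists e, c, M; split=> // [i|y].
  pose ci : {linear V -> R^o} := HB.pack (c i) (GRing.isLinear.Build _ _ _ _ (c i) (lc i)).
  exact: (@linear_form_continuous ci).
apply: dual_norm_le => v v1.
rewrite (le_trans (ler_norm _))// {1}(vE v) linear_sum.
rewrite (le_trans (ler_norm_sum _ _ _))// mulr_sumr ler_sum// => i _.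
rewrite linearZ /= normrM ler_wpM2r// (le_trans (cM i v))//.
by rewrite ler_piMr// ltW.
Qed.

Lemma dual_norm_dist y z : `|dual_norm y - dual_norm z| <= dual_norm (y \- z).
Proof.
have dN : dual_norm (z \- y) <= dual_norm (y \- z).
  apply: dual_norm_le => v v1; rewrite /= -opprB.
  rewrite (le_trans (ler_norm _))// normrN (le_trans (dual_norm_bound (y \- z) v))//.
  by rewrite ler_piMr// dual_norm_ge0.
have tri (a b : {linear V -> R^o}) : dual_norm a - dual_norm b <= dual_norm (a \- b).
  rewrite lerBlDr; apply: dual_norm_le => v v1.
  rewrite -[a v](subrK (b v)).
  rewrite lerD// (le_trans (ler_norm _))//.
    by rewrite (le_trans (dual_norm_bound (a \- b) v))// ler_piMr// dual_norm_ge0.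
  by rewrite (le_trans (dual_norm_bound b v))// ler_piMr// dual_norm_ge0.
by rewrite ler_norml tri andbT lerNl opprB (le_trans (tri z y)).
Qed.

End DualNorm.

(** * Measurability of sets through finitely many real functions *)

Section MeasurabilityByCoordinates.
Context (R : realType) d (T : measurableType d) (n : nat).

(* A set which is open in the topology induced by finitely many real functions
   is the countable union of the rational boxes which it contains. *)
Lemma measurable_by_coordinates (D A : set T) (Y : 'I_n -> T -> R) :
  measurable D -> (forall i, measurable_fun D (Y i)) -> A `<=` D ->
  (forall z, A z -> exists2 r : R, 0 < r &
    forall z', D z' -> (forall i, `|Y i z' - Y i z| < r) -> A z') ->
  measurable A.
Proof.
move=> mD mY AD Aopen.
pose box (qr : {ffun 'I_n -> rat} * rat) :=
  D `&` \bigcap_(i in [set: 'I_n]) [set z | `|Y i z - ratr (qr.1 i)| < ratr qr.2].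
have mbox qr : measurable (box qr).
  have -> : box qr = D `&` \bigcap_(i in [set: 'I_n])
      (D `&` (fun z => `|Y i z - ratr (qr.1 i)|) @^-1` `]-oo, ratr qr.2[).
    apply/seteqP; split=> z [Dz zb]; split=> // i _; have := zb i Logic.I => /=.
      by rewrite in_itv.
    by rewrite in_itv => -[].
  apply: measurableI => //; apply: fin_bigcap_measurable => // i _.
  have mi : measurable_fun D (fun z => `|Y i z - ratr (qr.1 i)|).
    by apply: measurableT_comp => //; apply: measurable_funB => //; exact: measurable_cst.
  exact: mi.
have -> : A = \bigcup_qr (if `[< box qr `<=` A >] then box qr else set0).
  apply/seteqP; split=> [z Az|z [qr _]]; last by case: asboolP => [boxA /boxA|_ []].
  have [r r0 rA] := Aopen z Az.
  (* The centre is within [r / 4] of [z] in each coordinate and the radius lies between [r / 4] and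
     [r / 2]: the box contains [z], and its points are within [3 r / 4] of [z]. *)
  have [q q_rat] : exists q : {ffun 'I_n -> rat},
      forall i, ratr (q i) \in `](Y i z - r / 4), (Y i z + r / 4)[.
    have h i : exists q : rat, ratr q \in `](Y i z - r / 4), (Y i z + r / 4)[.
      by apply: rat_in_itvoo; lra.
    by exists [ffun i => xchoose (h i)] => i; rewrite ffunE; exact: (xchooseP (h i)).
  have [s] : exists s : rat, ratr s \in `](r / 4), (r / 2)[.
    by apply: rat_in_itvoo; lra.
  rewrite in_itv /= => /andP[s1 s2].
  exists (q, s) => //; rewrite asboolT.
    split; first exact: AD.
    move=> i _ /=; have := q_rat i; rewrite in_itv /= => /andP[q1 q2].
    by rewrite ltr_norml; apply/andP; split; lra.
  move=> z' [Dz' z'b]; apply: rA => // i.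
  have := z'b i Logic.I => /=; have := q_rat i; rewrite in_itv /= => /andP[q1 q2].
  by rewrite !ltr_norml => /andP[? ?]; apply/andP; split; lra.
apply: countable_bigcupT_measurable => [|qr]; last by case: ifP.
exact: countableP.
Qed.

End MeasurabilityByCoordinates.

(** * Scalar inequalities for the descent step *)

Section RealInequalities.
Context (R : realType).

(** For [u <= 1], completing the square bounds the left side by [u ^+ 2 / K], and [u ^+ 2 <= u]^
    p[since]p <= 2[. For]u > 1[the linear term alone is at most]D * u[, and]u <= u [^ p] since
    [p >= 1]. The sum of the two constants covers both cases. *)
Lemma quadratic_gap_le_powR (p K D u delta : R) : 1 < p <= 2 -> 0 < K ->
  0 <= u -> 0 <= delta <= D ->
  u * delta - K / 4 * delta ^+ 2 <= (K^-1 + D) * u `^ p.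
Proof.
move=> /andP[p1 p2] K0 u0 /andP[d0 dD].
have [->|un0] := eqVneq u 0.
  rewrite powR0 ?gt_eqF//; last lra.
  by rewrite mul0r mulr0 sub0r oppr_le0 mulr_ge0// ?sqr_ge0//; lra.
have u_gt0 : 0 < u by rewrite lt_neqAle eq_sym un0.
have up0 : 0 < u `^ p by exact: powR_gt0.
have [u1|u1] := leP u 1.
  have uup : u ^+ 2 <= u `^ p.
    by rewrite -powR_mulrn// ger_powR// u_gt0.
  have : u * delta - K / 4 * delta ^+ 2 <= K^-1 * u ^+ 2.
    have -> : K^-1 * u ^+ 2 =
        u * delta - K / 4 * delta ^+ 2 + K / 4 * (delta - 2 / K * u) ^+ 2.
      by field; rewrite gt_eqF.
    by rewrite lerDl mulr_ge0 ?sqr_ge0//; lra.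
  move/le_trans; apply; rewrite mulrDl -[leLHS]addr0 lerD//.
    by rewrite ler_wpM2l// invr_ge0 ltW.
  by rewrite mulr_ge0 ?powR_ge0// (le_trans d0).
have uup : u <= u `^ p by rewrite le1r_powR// ltW.
have a : u * delta <= D * u `^ p.
  by rewrite mulrC ler_pM.
have b : 0 <= K / 4 * delta ^+ 2 by rewrite mulr_ge0 ?sqr_ge0//; lra.
have c : 0 <= K^-1 * u `^ p by rewrite mulr_ge0 ?invr_ge0 ?powR_ge0// ltW.
rewrite mulrDl; lra.
Qed.

Lemma linear_recursion_bound (q : R) (a b : nat -> R) : 0 <= q ->
  (forall t, (0 < t)%N -> a t.+1 <= q * a t + b t) ->
  forall t, a t.+1 <= q ^+ t * a 1%N + \sum_(1 <= s < t.+1) q ^+ (t - s) * b s.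
Proof.
move=> q0 rec; elim=> [|t IH]; first by rewrite big_geq// expr0 mul1r addr0.
rewrite (le_trans (rec t.+1 isT))// big_nat_recr//= subnn expr0 mul1r addrA lerD2r.
rewrite (le_trans (ler_wpM2l q0 IH))// mulrDr mulrA -exprS lerD2l mulr_sumr.
rewrite le_eqVlt; apply/orP; left; apply/eqP; apply: eq_big_nat => s /andP[_ st].
by rewrite mulrA -exprS subSn.
Qed.

End RealInequalities.

(** * Subgradients, mirror map and Bregman divergence of a steep regularizer *)

Section MirrorGeometry.
Context (R : realType) (V : normedModType R) (n : nat).
Hypothesis Vdim : Vector.axiom n V.
Context (X : set V) (K : R) (h : V -> \bar R) (gh : V -> {linear V -> R^o}).
Hypothesis reg : regularizer X K h gh.
Implicit Types y : {linear V -> R^o}.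

Lemma dual_continuousP (D : set V) (g : V -> {linear V -> R^o}) x :
  dual_continuous_on D g -> D x ->
  forall e : R, 0 < e -> exists2 r : R, 0 < r &
    forall x', D x' -> `|x' - x| < r -> dual_norm (g x' \- g x) < e.
Proof.
move=> gc Dx e e0; have /cvgrPdist_lt/(_ e e0) := gc x Dx.
rewrite near_withinE => /nbhs_ballP[r /= r0 rP]; exists r => // x' Dx' x'x.
have := rP x'; rewrite -ball_normE /= distrC => /(_ x'x Dx').
by rewrite distrC subr0 => /(le_lt_trans (ler_norm _)).
Qed.

Lemma regularizer_fin_num x : X x -> h x \is a fin_num.
Proof.
case: reg => -[hNy _] domh _ _ _; rewrite -domh /edom /= => hx.
by rewrite fin_numElt hx andbT ltNye hNy.
Qed.

Lemma regularizerE x : X x -> h x = (fine (h x))%:E.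
Proof. by move=> /regularizer_fin_num/fineK ->. Qed.

Lemma subdiff_ineq y x x' : X x -> X x' -> subdiff h x y ->
  fine (h x) + y (x' - x) <= fine (h x').
Proof.
by move=> Xx Xx' /(_ x'); rewrite (regularizerE Xx) (regularizerE Xx') -EFinD lee_fin.
Qed.

(** Optimality over [X] is the subgradient inequality on [X]; outside [X] it is trivial because [h]
    is infinite there. *)
Lemma mirror_subdiff y x : mirror X h y x -> subdiff h x y.
Proof.
move=> [Xx xmax] x'; have [Xx'|nXx'] := pselect (X x'); last first.
  case: reg => _ domh _ _ _; have : ~ edom h x' by rewrite domh.
  by rewrite /edom /= => /negP; rewrite -leNgt leye_eq => /eqP ->; rewrite leey.
have := xmax x' Xx'; rewrite (regularizerE Xx) (regularizerE Xx').
rewrite -!EFinB -EFinD !lee_fin linearB /=; lra.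
Qed.

Hypothesis st : steep X h.

Lemma dom_subdiff_sub x : dom_subdiff h x -> X x.
Proof. by rewrite st => -[]. Qed.

(** The parameter [s] may be negative, which allows steps from [x] away from [x'] as well as towards
    it. *)
Lemma affine_hull_line (A : set V) (x x' : V) (s : R) : A x -> A x' ->
  affine_hull A (x + s *: (x' - x)).
Proof.
move=> Ax Ax'; exists 2%N, (fun i => if i == ord0 then 1 - s else s).
exists (fun i => if i == ord0 then x else x'); split.
- by move=> i; case: ifP.
- by rewrite big_ord_recl big_ord1 /= subrK.
- by rewrite big_ord_recl big_ord1 /= scalerBl scale1r scalerBr addrAC addrA.
Qed.

Lemma relint_radius (A : set V) x : relint A x -> exists2 r : R, 0 < r &
  forall z, affine_hull A z -> `|z - x| < r -> relint A z.
Proof.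
move=> [Ax]; rewrite /within /= => /nbhs_ballP[r /= r0 rP]; exists r => // z Az zx.
have bz : ball x r z by rewrite -ball_normE /= distrC.
split; first exact: (rP z).
rewrite /within /=; apply: (@filterS _ (nbhs z) _ (ball x r)).
  by move=> z' bz' Az'; exact: (rP z').
apply: open_nbhs_nbhs; split => //; exact: ball_open.
Qed.

(* Steepness makes [h] differentiable along [X] at [x]: by monotonicity of the
   subdifferential [y] is squeezed between the values of the continuous
   selection on both sides of [x]. *)
Lemma steep_subgradient_unique y x x' : subdiff h x y -> X x' ->
  y (x' - x) = gh x (x' - x).
Proof.
move=> yx Xx'; have dx : dom_subdiff h x by exists y.
have Xx := dom_subdiff_sub dx.
case: (reg) => _ _ _ [ghsub ghcont] _.
have : relint X x by rewrite -st.
move=> /relint_radius[r r0 rP].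
pose v := x' - x.
(* Adding the subgradient inequalities at [x] and [x + s' *: v] gives [y (s' *: v) <= gh (x + s' *:
   v) (s' *: v)]. Continuity of [gh] replaces the base point by [x] at a cost of at most [s * e].
   The step is short enough for both the relative interior ([r]) and the continuity estimate
   ([r']). *)
have nearby (e : R) : 0 < e -> exists2 s : R, 0 < s & forall s' : R, `|s'| = s ->
    y (s' *: v) <= gh x (s' *: v) + s * e.
  move=> e0; pose e' := e / (`|v| + 1).
  have e'0 : 0 < e' by rewrite divr_gt0// ltr_wpDl.
  have [r' r'0 r'P] := dual_continuousP ghcont dx e'0.
  pose s := Num.min r r' / (`|v| + 1) / 2.
  have s0 : 0 < s by rewrite !divr_gt0// ?ltr_wpDl// lt_min r0.
  exists s => // s' s's.
  have small : `|s' *: v| < Num.min r r'.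
    have m0 : 0 < Num.min r r' by rewrite lt_min r0.
    have sE : s * (`|v| + 1) = Num.min r r' / 2.
      by rewrite /s mulrAC divfK// gt_eqF// ltr_wpDl.
    by rewrite normrZ s's; move: sE; rewrite mulrDr; lra.
  move: small; rewrite lt_min => /andP[small1 small2].
  have rx : relint X (x + s' *: v).
    by apply: rP; [exact: affine_hull_line|rewrite addrC addKr].
  have dx1 : dom_subdiff h (x + s' *: v) by rewrite st.
  have Xx1 := dom_subdiff_sub dx1.
  have i1 := subdiff_ineq Xx Xx1 yx.
  have i2 := subdiff_ineq Xx1 Xx (ghsub _ dx1).
  have e1 : x + s' *: v - x = s' *: v by rewrite addrC addKr.
  have e2 : x - (x + s' *: v) = - (s' *: v) by rewrite opprD addNKr.
  have i3 := r'P _ dx1; rewrite e1 in i3; have {}i3 := i3 small2.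
  have i4 := dual_norm_bound Vdim (gh (x + s' *: v) \- gh x) (s' *: v).
  rewrite e1 in i1; rewrite e2 linearN in i2.
  have i5 : dual_norm (gh (x + s' *: v) \- gh x) * `|s' *: v| <= s * e.
    rewrite normrZ s's mulrCA ler_pM2l//.
    rewrite (le_trans (ler_wpM2r (normr_ge0 v) (ltW i3)))// /e' mulrAC -mulrA.
    by rewrite ler_piMr ?ltW// ltr_pdivrMr ?ltr_wpDl// mul1r ltrDl.
  have i6 := ler_norm ((gh (x + s' *: v) \- gh x) (s' *: v)).
  move: i1 i2 i4 i5 i6; rewrite /=; lra.
(* The choices [s' = s] and [s' = - s] give the two opposite inequalities up to [e]. *)
apply/eqP; rewrite eq_le; apply/andP; split; apply/ler_addgt0Pr => e e0.
  have [s s0 /(_ s)] := nearby e e0; rewrite gtr0_norm// => /(_ erefl).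
  by rewrite !linearZ /= -mulrDr ler_pM2l.
have [s s0 /(_ (- s))] := nearby e e0; rewrite normrN gtr0_norm// => /(_ erefl).
have sE (a : R^o) : - s *: a = - (s * a) by exact: mulNr.
rewrite !linearZ /= !sE => h1.
by rewrite -(ler_pM2l s0) mulrDr; move: h1; rewrite -/v; lra.
Qed.

(** Strong convexity is assumed for the selection [gh] only; uniqueness along [X] extends it to
    every subgradient, in particular to the scaled dual iterates. *)
Lemma steep_strong_convexity y x x' : subdiff h x y -> X x' ->
  fine (h x) + y (x' - x) + K / 2 * `|x' - x| ^+ 2 <= fine (h x').
Proof.
move=> yx Xx'; have dx : dom_subdiff h x by exists y.
have Xx := dom_subdiff_sub dx; rewrite (steep_subgradient_unique yx Xx').
case: (reg) => _ _ _ _ /(_ x x' dx Xx').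
by rewrite (regularizerE Xx) (regularizerE Xx') -!EFinD lee_fin.
Qed.

(** Adding strong convexity from [x] to [x'] and back gives [K * |x' - x|^2 <= (y' - y) (x' - x)];
    then divide by the distance. This Lipschitz property of the mirror map later makes the iterates
    measurable. *)
Lemma mirror_lipschitz y y' x x' : subdiff h x y -> subdiff h x' y' ->
  K * `|x' - x| <= dual_norm (y' \- y).
Proof.
move=> yx yx'; have [->|xx'] := eqVneq x' x.
  by rewrite subrr normr0 mulr0 (dual_norm_ge0 Vdim).
have Xx : X x by apply: dom_subdiff_sub; exists y.
have Xx' : X x' by apply: dom_subdiff_sub; exists y'.
have d0 : 0 < `|x' - x| by rewrite normr_gt0 subr_eq0.
have i1 := steep_strong_convexity yx Xx'.
have := steep_strong_convexity yx' Xx; rewrite distrC -opprB linearN => i2.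
have i3 := le_trans (ler_norm _) (dual_norm_bound Vdim (y' \- y) (x' - x)).
by rewrite -(ler_pM2r d0); move: i1 i2 i3; rewrite /= expr2; lra.
Qed.

Local Notation breg x' x := (fine (h x') - fine (h x) - gh x (x' - x)).

Lemma bregmanE x' x : dom_subdiff h x -> X x' -> bregman h gh x' x = (breg x' x)%:E.
Proof.
move=> dx Xx'; rewrite /bregman (regularizerE (dom_subdiff_sub dx)) (regularizerE Xx').
by rewrite -!EFinB.
Qed.

Lemma bregman_lower_bound x' x : dom_subdiff h x -> X x' ->
  K / 2 * `|x' - x| ^+ 2 <= breg x' x.
Proof.
move=> dx Xx'; case: (reg) => _ _ _ [/(_ _ dx) ghx _] _.
have := steep_strong_convexity ghx Xx'; lra.
Qed.

(** The three-point identity gives [breg xs x1 = breg xs x - breg x1 x + eta * (gf x + U) (xs -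
    x1)]. Strong convexity towards [xs], smoothness towards [x1] and minimality of [xs] bound the
    gradient part by [eta * L * breg x1 x - eta * mu * breg xs x]. Half of [breg x1 x] absorbs the
    smoothness error; the other half is at least [K / 4 * |x1 - x|^2] and absorbs [eta * U (x - x1)]
    through [quadratic_gap_le_powR]. *)
Lemma sda_descent (f : V -> \bar R) (gf : V -> {linear V -> R^o}) (mu L eta p D : R)
    (U y y1 : {linear V -> R^o}) (xs x x1 : V) :
  (forall z, X z -> f z \is a fin_num) ->
  rel_strongly_convex X h gh f gf mu -> rel_smooth X h gh f gf L ->
  minimizer X f xs ->
  0 < K -> 1 < p <= 2 -> 0 < eta -> eta * L <= 1 / 2 -> `|x1 - x| <= D ->
  subdiff h x y -> subdiff h x1 y1 ->
  (forall v, y1 v = y v - eta * (gf x v + U v)) ->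
  breg xs x1 <= (1 - eta * mu) * breg xs x +
    (eta * U (xs - x) + (K^-1 + D) * (eta * dual_norm U) `^ p).
Proof.
move=> ffin sc sm [Xxs xsmin] K0 pP eta0 etaL x1D yx yx1 y1E.
have dx : dom_subdiff h x by exists y.
have dx1 : dom_subdiff h x1 by exists y1.
have Xx := dom_subdiff_sub dx; have Xx1 := dom_subdiff_sub dx1.
have fE z : X z -> f z = (fine (f z))%:E by move=> /ffin/fineK ->.
have := sc x xs dx Xxs; rewrite bregmanE// (fE x)// (fE xs)//.
rewrite -!EFinM -!EFinD lee_fin => isc.
have := sm x x1 dx Xx1; rewrite bregmanE// (fE x)// (fE x1)//.
rewrite -!EFinM -!EFinD lee_fin => ism.
have := xsmin x1 Xx1; rewrite (fE x1)// (fE xs)// lee_fin => imin.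
have iB := bregman_lower_bound dx Xx1.
have iL : eta * L * breg x1 x <= 1 / 2 * breg x1 x.
  by rewrite ler_wpM2r// (le_trans _ iB)// mulr_ge0 ?sqr_ge0//; lra.
have iU := dual_norm_bound Vdim U (x - x1); rewrite distrC in iU.
have {}iU := ler_wpM2l (ltW eta0) (le_trans (ler_norm _) iU).
have d0 := dual_norm_ge0 Vdim U.
have gap : eta * dual_norm U * `|x1 - x| - K / 4 * `|x1 - x| ^+ 2 <=
    (K^-1 + D) * (eta * dual_norm U) `^ p.
  by apply: quadratic_gap_le_powR; rewrite ?normr_ge0 ?x1D// mulr_ge0// ltW.
have {}isc := ler_wpM2l (ltW eta0) isc.
have {}ism := ler_wpM2l (ltW eta0) ism.
have {}imin := ler_wpM2l (ltW eta0) imin.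
have e1 := steep_subgradient_unique yx1 Xxs.
have e2 := steep_subgradient_unique yx Xxs.
have e3 := steep_subgradient_unique yx Xx1.
move: isc ism imin iB iL iU gap e1 e2 e3; rewrite !y1E !linearB /=.
set P := (K^-1 + D) * _; lra.
Qed.

End MirrorGeometry.

(** * Fubini for a random point and an independent seed *)

Section IndependentFubini.
Context (R : realType) d (Om : measurableType d) (P : probability Om R).
Context d1 (T : measurableType d1) d2 (S : measurableType d2).
Context (X : Om -> T) (Z Z1 : Om -> S).
Hypotheses (mX : measurable_fun setT X) (mZ : measurable_fun setT Z)
  (mZ1 : measurable_fun setT Z1).
Hypothesis indep : forall A B, measurable A -> measurable B ->
  P (X @^-1` A `&` Z @^-1` B) = (P (X @^-1` A) * P (Z1 @^-1` B))%E.

Let X' : {mfun Om >-> T} := HB.pack X (isMeasurableFun.Build _ _ _ _ X mX).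
Let Z' : {mfun Om >-> S} := HB.pack Z1 (isMeasurableFun.Build _ _ _ _ Z1 mZ1).
Let mXZ : measurable_fun setT (fun w => (X w, Z w)).
Proof. exact: measurable_fun_pair. Qed.
Let XZ : {mfun Om >-> (T * S)%type} :=
  HB.pack (fun w => (X w, Z w)) (isMeasurableFun.Build _ _ _ _ _ mXZ).

(** By [indep] the joint law of [X] and [Z] takes product values on rectangles, hence is the product
    measure. The second factor is the law of the reference seed [Z1], in terms of which the noise
    assumptions are stated. *)
Let jointE (F : T * S -> \bar R) :
  (\int[distribution P X' \x distribution P Z']_z F z =
   \int[distribution P XZ]_z F z)%E.
Proof.
by apply: eq_measure_integral => A mA _; exact: product_measure_unique.
Qed.

Local Open Scope ereal_scope.

(** By Tonelli, a bound uniform over frozen values of [X] survives averaging over the probability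
    law of [X]. *)
Lemma ge0_integral_independent_le (F : T * S -> \bar R) (c : R) :
  measurable_fun setT F -> (forall z, 0 <= F z) ->
  (forall x, \int[P]_w F (x, Z1 w) <= c%:E) ->
  \int[P]_w F (X w, Z w) <= c%:E.
Proof.
move=> mF F0 Fc; have -> : \int[P]_w F (X w, Z w) = \int[distribution P XZ]_z F z.
  by rewrite ge0_integral_distribution.
rewrite -jointE fubini_tonelli1//.
have -> : c%:E = \int[distribution P X']_x (cst c%:E x).
  rewrite integral_cst// /= /distribution /pushforward preimage_setT.
  by rewrite probability_setT mule1.
apply: ge0_le_integral => //.
- by move=> x _; exact: integral_ge0.
- exact: measurable_fun_fubini_tonelli_F.
- move=> x _; apply: le_trans (Fc x); rewrite /fubini_F /= ge0_integral_distribution//.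
  by apply: measurableT_comp => //; exact: measurable_pair1.
Qed.

Lemma integral_independent0 (F : T * S -> \bar R) :
  measurable_fun setT F -> P.-integrable setT (fun w => F (X w, Z w)) ->
  (forall x, P.-integrable setT (fun w => F (x, Z1 w))) ->
  (forall x, \int[P]_w F (x, Z1 w) = 0) ->
  \int[P]_w F (X w, Z w) = 0.
Proof.
move=> mF iF iFx Fx0; transitivity (\int[distribution P XZ]_z F z).
  by rewrite integral_distribution.
(* Fubini needs integrability for the product law, which [jointE] transports from the joint law. *)
rewrite -jointE -integral12_prod_meas1; last first.
  apply/integrableP; split=> //; rewrite jointE ge0_integral_distribution//.
    by have /integrableP[] := iF.
  by apply: measurableT_comp.
apply: integral0_eq => x _; rewrite /fubini_F /= integral_distribution//.
- exact: Fx0.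
- by apply: measurableT_comp => //; exact: measurable_pair1.
- exact: iFx.
Qed.

End IndependentFubini.

(** * The sigma-algebra generated by the past seeds *)

Section Past.
Context (R : realType) d (Om : measurableType d) (P : probability Om R).
Context dS (S : measurableType dS) (seed : nat -> Om -> S).
Hypothesis seed_iid : iid P seed.

(* Cylinder events of the seeds of indices [1, ..., t - 1]. *)
Definition past (t : nat) : set (set Om) :=
  [set A | exists2 B : nat -> set S, (forall i, measurable (B i)) &
    A = \bigcap_(i in [set` index_iota 1 t]) seed i @^-1` B i].

Lemma past_setI t : setI_closed (past t).
Proof.
move=> _ _ [B mB ->] [C mC ->]; exists (fun i => B i `&` C i).
  by move=> i; exact: measurableI.
by rewrite -bigcapI; apply: eq_bigcapr => i _; rewrite preimage_setI.
Qed.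

Lemma pastT t : past t setT.
Proof.
exists (fun=> setT) => //.
by apply/seteqP; split=> // w _ i _.
Qed.

Lemma past_sub_measurable t : past t `<=` measurable.
Proof.
move=> _ [B mB ->]; apply: fin_bigcap_measurable => [|i]; first exact: finite_seq.
rewrite /= mem_index_iota => /andP[i0 _]; rewrite -[X in measurable X]setTI.
by case: seed_iid => + _ _; apply.
Qed.

Lemma past_homo t t' : (t <= t')%N -> <<s past t >> `<=` <<s past t' >>.
Proof.
move=> tt'; apply: smallest_sub => [|_ [B mB ->]]; first exact: smallest_sigma_algebra.
apply: sub_sigma_algebra.
exists (fun i => if (i < t)%N then B i else setT).
  by move=> i; case: ifP.
apply/seteqP; split=> w h i /=; rewrite mem_index_iota => /andP[i0 it].
  by case: ifPn => // it'; apply: h; rewrite /= mem_index_iota i0.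
by have := h i; rewrite /= mem_index_iota i0 (leq_trans it tt') it; apply.
Qed.

Lemma past_seed s t : (0 < s < t)%N ->
  measurable_fun setT (seed s : g_sigma_algebraType (past t) -> S).
Proof.
move=> /andP[s0 st] _ B mB; rewrite setTI; apply: sub_sigma_algebra.
exists (fun i => if i == s then B else setT).
  by move=> i; case: ifP.
apply/seteqP; split=> w /= h => [i _|]; first by case: eqP => [->|].
by have := h s; rewrite /= mem_index_iota s0 st eqxx; apply.
Qed.

Lemma past_measurable t : <<s past t >> `<=` measurable.
Proof.
by apply: smallest_sub; [exact: sigma_algebra_measurable|exact: past_sub_measurable].
Qed.

(** As functions of [A], both sides are finite measures, a restriction and a rescaling of [P]. They
    agree on cylinders, which are stable under intersection, hence on the generated
    sigma-algebra. *)
Lemma past_independent t A B : (0 < t)%N -> <<s past t >> A -> measurable B ->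
  P (A `&` seed t @^-1` B) = (P A * P (seed 1%N @^-1` B))%E.
Proof.
move=> t0 + mB; case: seed_iid => mseed seed_id seed_ind.
have mtB : measurable (seed t @^-1` B).
  by rewrite -[X in measurable X]setTI; exact: mseed.
rewrite -(seed_id t B t0 mB).
pose r : {nonneg R} := NngNum (fine_ge0 (measure_ge0 P (seed t @^-1` B))).
have rE : (r%:num)%:E = P (seed t @^-1` B) by rewrite /= fineK// fin_num_measure.
move: A; suff : forall A, <<s past t >> A -> mrestr P mtB A = mscale r P A.
  by move=> h A /h; rewrite /mrestr /mscale rE muleC.
apply: (g_sigma_algebra_measure_unique (past t) (past_sub_measurable (t:=t)) (fun=> setT)).
- by move=> _; exact: pastT.
- by rewrite bigcup_const//; exists 0%N.
- exact: past_setI.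
- move=> _ [C mC ->]; rewrite /= /mrestr /mscale rE.
  (* One family of events for the indices [1, ..., t], so that the product formula applies to the
     cylinder and the present seed at once. *)
  pose D i := if i == t then B else C i.
  have mD i : i \in t :: index_iota 1 t -> (0 < i)%N /\ measurable (D i).
    rewrite inE mem_index_iota /D => /orP[/eqP ->|/andP[i0 _]]; first by rewrite eqxx.
    by case: ifP.
  have uD : uniq (t :: index_iota 1 t).
    by rewrite /= iota_uniq mem_index_iota ltnn andbF.
  have DE i : i \in index_iota 1 t -> D i = C i.
    by rewrite mem_index_iota /D => /andP[_]; case: eqP => // ->; rewrite ltnn.
  have := seed_ind _ D uD mD; rewrite big_cons {2}/D eqxx.
  have <- : P (\bigcap_(i in [set` index_iota 1 t]) seed i @^-1` C i) =
      (\prod_(i <- index_iota 1 t) P (seed i @^-1` D i))%E.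
    rewrite seed_ind ?iota_uniq//; last first.
      by move=> i; rewrite mem_index_iota => /andP[].
    by apply: eq_big_seq => i /DE ->.
  move=> <-; congr (P _); apply/seteqP; split=> w /=.
    move=> [wC wt] i /=; rewrite inE => /orP[/eqP ->|it]; first by rewrite /D eqxx.
    by rewrite /preimage /= DE//; exact: wC.
  move=> wD; split=> [i /= it|]; first by have := wD i; rewrite /= inE it orbT DE//; apply.
  by have := wD t; rewrite /= inE eqxx /D eqxx; apply.
- by move=> _; rewrite /= /mrestr setTI (le_lt_trans (probability_le1 _ _))// ltry.
Qed.

End Past.

(** * Borel maps on the normed space *)

Section BorelMaps.
Context (R : realType) (V : normedModType R) d (T : measurableType d).

Lemma measurable_to_borel (D : set T) (g : T -> borel V) :
  (forall O : set V, open O -> measurable (D `&` g @^-1` O)) -> measurable_fun D g.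
Proof.
move=> h; apply: (@measurability _ _ _ (borel V) _ _ (@open V)) => // _ [A oA <-].
exact: h.
Qed.

Lemma measurable_to_real (D : set T) (g : T -> R) :
  (forall O : set R, open O -> measurable (D `&` g @^-1` O)) -> measurable_fun D g.
Proof.
move=> h; apply: (measurability _ (RGenOpens.measurableE R)) => _ [A oA <-].
by apply: h; case: oA => a [b ->]; exact: interval_open.
Qed.

(* Only the values of [g] on [D] matter, and the trace of an open set under a
   function continuous on [D] is the trace of an open set. *)
Lemma measurable_continuous_on_comp (D : set V) (g : V -> R) (x : T -> borel V) :
  (forall v, D v -> forall e : R, 0 < e -> exists2 r : R, 0 < r &
    forall v', D v' -> `|v' - v| < r -> `|g v' - g v| < e) ->
  measurable_fun setT x -> (forall w, D (x w)) ->
  measurable_fun setT (fun w => g (x w)).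
Proof.
move=> gc mx Dx; apply: measurable_to_real => O oO; rewrite setTI.
pose W := interior [set v' | D v' -> O (g v')].
have -> : (fun w => g (x w)) @^-1` O = x @^-1` W.
  apply/seteqP; split=> w /= => [Ow|/nbhs_singleton]; last exact.
  have : nbhs (g (x w)) O by exact: open_nbhs_nbhs.
  move=> /nbhs_ballP[e /= e0 eO]; have [r r0 rP] := gc _ (Dx w) e e0.
  apply/nbhs_ballP; exists r => //= v' xv' Dv'; apply: eO.
  rewrite -ball_normE /= distrC; apply: rP => //.
  by move: xv'; rewrite -ball_normE /= distrC.
rewrite -[X in measurable X]setTI; apply: mx => //.
by apply: sub_sigma_algebra; exact: open_interior.
Qed.

End BorelMaps.

Lemma measurable_continuous_borel (R : realType) (V : normedModType R)
    (g : V -> R) : continuous g ->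
  measurable_fun setT (g : borel V -> R).
Proof.
move=> gc; apply: measurable_to_real => O oO; rewrite setTI.
by apply: sub_sigma_algebra; move/continuousP: gc; apply.
Qed.


(** * Joint measurability of noise functionals *)

Section Noise.
Context (R : realType) (V : normedModType R) (n : nat).
Hypothesis Vdim : Vector.axiom n V.
Context dS (S : measurableType dS) (D : set V) (U : V -> S -> {linear V -> R^o}).
Hypothesis mD : measurable (D : set (borel V)).
Hypothesis mU : forall v : V, measurable_fun ((D : set (borel V)) `*` [set: S])
  (fun z : (borel V * S)%type => (U z.1 z.2 v : R)).

Let mDT : measurable ((D : set (borel V)) `*` [set: S]).
Proof. exact: measurableX. Qed.

(** The dual norm depends continuously on the values of the form at the finitely many vectors [e i],
    and these values are jointly measurable. *)
Lemma measurable_noise_dual_norm : measurable_fun ((D : set (borel V)) `*` [set: S])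
  (fun z : (borel V * S)%type => dual_norm (U z.1 z.2)).
Proof.
have [e [c [M [M0 _ _ dM]]]] := dual_norm_coordinates Vdim.
apply: measurable_to_real => W oW.
apply: (measurable_by_coordinates (D := (D : set (borel V)) `*` [set: S])
  (Y := fun i z => U z.1 z.2 (e i))) => //.
move=> z [Dz Wz]; have : nbhs (dual_norm (U z.1 z.2)) W by exact: open_nbhs_nbhs.
(* Using [n.+1] instead of [n] keeps [C] positive in dimension zero and makes the final comparison
   strict. *)
move=> /nbhs_ballP[r /= r0 rW]; pose C := M * n.+1%:R.
have C0 : 0 < C by rewrite mulr_gt0.
exists (r / C) => [|z' Dz' z'z]; first by rewrite divr_gt0.
split=> //; apply: rW; rewrite -ball_normE /= distrC.
rewrite (le_lt_trans (dual_norm_dist Vdim _ _))// (le_lt_trans (dM _))//.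
rewrite (@le_lt_trans _ _ (M * \sum_(i < n) r / C))//.
  by rewrite ler_wpM2l ?(ltW M0)// ler_sum// => i _; rewrite ltW// z'z.
rewrite sumr_const card_ord -mulr_natl.
have -> : M * (n%:R * (r / C)) = r * (M * n%:R / C) by ring.
rewrite gtr_pMr// ltr_pdivrMr// mul1r.
by rewrite /C ltr_pM2l// ltr_nat.
Qed.

(** Measurability is assumed at fixed vectors only, whereas [xs - z.1] moves; expanding it in
    coordinates leaves products of continuous functions and values at the fixed [e i]. *)
Lemma measurable_noise_pairing (xs : V) : measurable_fun ((D : set (borel V)) `*` [set: S])
  (fun z : (borel V * S)%type => (U z.1 z.2 (xs - z.1) : R)).
Proof.
have [e [c [M [M0 vE cc _]]]] := dual_norm_coordinates Vdim.
have -> : (fun z : (borel V * S)%type => (U z.1 z.2 (xs - z.1) : R)) =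
    fun z => \sum_(i < n) c i (xs - z.1) * U z.1 z.2 (e i).
  apply/funext => z; rewrite {1}(vE (xs - z.1)) linear_sum.
  by apply: eq_bigr => i _; rewrite linearZ.
apply: measurable_sum => i; apply: measurable_funM => //.
apply: measurable_funTS.
have mc : measurable_fun setT ((fun x => c i (xs - x)) : borel V -> R).
  apply: measurable_continuous_borel => x; apply: continuous_comp; last exact: cc.
  by apply: cvgB; [exact: cvg_cst|exact: cvg_id].
exact: (measurableT_comp mc measurable_fst).
Qed.

End Noise.

(** * Moments of the noise at a random query point *)

Section NoiseMoments.
Context (R : realType) (V : normedModType R) (n : nat).
Hypothesis Vdim : Vector.axiom n V.
Context d (Om : measurableType d) (P : probability Om R).
Context dS (S : measurableType dS) (D : set V) (U : V -> S -> {linear V -> R^o}).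
Hypothesis mD : measurable (D : set (borel V)).
Hypothesis mU : forall v : V, measurable_fun ((D : set (borel V)) `*` [set: S])
  (fun z : (borel V * S)%type => (U z.1 z.2 v : R)).
Context (X : Om -> borel V) (Z Z1 : Om -> S) (p sigma : R).
Hypotheses (mX : measurable_fun setT X) (mZ : measurable_fun setT Z)
  (mZ1 : measurable_fun setT Z1) (DX : forall w, D (X w)).
Hypothesis indep : forall (A : set (borel V)) (B : set S), measurable A -> measurable B ->
  P (X @^-1` A `&` Z @^-1` B) = (P (X @^-1` A) * P (Z1 @^-1` B))%E.
Hypothesis p1 : 1 < p.
Hypothesis Umean : forall x v, D x -> ('E_P[fun w => U x (Z1 w) v] = 0)%E.
Hypothesis Umoment : forall x, D x ->
  ('E_P[fun w => (dual_norm (U x (Z1 w)) `^ p)%R] <= (sigma `^ p)%:E)%E.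

Let DT := (D : set (borel V)) `*` [set: S].

Let mDT : measurable DT.
Proof. exact: measurableX. Qed.

(** Extension by zero off [DT]: the Fubini lemmas want functions measurable on the whole product,
    while the noise is controlled on [D] only. The same device defines [G] below. *)
Let Fp : borel V * S -> \bar R :=
  (fun z : (borel V * S)%type => (dual_norm (U z.1 z.2) `^ p)%:E) \_ DT.

Let FpE x s : D x -> Fp (x, s) = (dual_norm (U x s) `^ p)%:E.
Proof. by move=> Dx; rewrite /Fp patchE mem_set. Qed.

Let FpN x s : ~ D x -> Fp (x, s) = 0%E.
Proof. by move=> Dx; rewrite /Fp patchE memNset// => -[]. Qed.

Let Fp_ge0 z : (0 <= Fp z)%E.
Proof.
case: z => x s; have [Dx|Dx] := pselect (D x); last by rewrite FpN.
by rewrite FpE// lee_fin powR_ge0.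
Qed.

Let mFp : measurable_fun setT Fp.
Proof.
apply/(measurable_restrictT _ mDT)/measurable_EFinP.
apply: (measurableT_comp (measurable_powR _)) => //.
exact: (measurable_noise_dual_norm Vdim mD mU).
Qed.

Let Fp_moment x : (\int[P]_w Fp (x, Z1 w) <= (sigma `^ p)%:E)%E.
Proof.
have [Dx|Dx] := pselect (D x).
  by under eq_integral do rewrite FpE//; have := Umoment Dx; rewrite unlock.
by under eq_integral do rewrite FpN//; rewrite integral0 lee_fin powR_ge0.
Qed.

Lemma noise_moment :
  (\int[P]_w (dual_norm (U (X w) (Z w)) `^ p)%:E <= (sigma `^ p)%:E)%E.
Proof.
under eq_integral do rewrite -FpE//.
exact: (ge0_integral_independent_le mX mZ mZ1 indep mFp Fp_ge0 Fp_moment).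
Qed.

Lemma noise_moment_integrable :
  P.-integrable setT (fun w => (dual_norm (U (X w) (Z w)) `^ p)%:E).
Proof.
apply/integrableP; split.
  rewrite (_ : (fun _ => _) = Fp \o (fun w => (X w, Z w))); last first.
    by apply/funext => w /=; rewrite FpE.
  by apply: measurableT_comp => //; exact: measurable_fun_pair.
under eq_integral do rewrite gee0_abs ?lee_fin ?powR_ge0//.
by rewrite (le_lt_trans noise_moment)// ltry.
Qed.

Context (xs : V) (B : R).
Hypothesis DB : forall x, D x -> `|xs - x| <= B.

Let G : borel V * S -> \bar R :=
  (fun z : (borel V * S)%type => (U z.1 z.2 (xs - z.1) : R)%:E) \_ DT.

Let GE x s : D x -> G (x, s) = (U x s (xs - x) : R)%:E.
Proof. by move=> Dx; rewrite /G patchE mem_set. Qed.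

Let GN x s : ~ D x -> G (x, s) = 0%E.
Proof. by move=> Dx; rewrite /G patchE memNset// => -[]. Qed.

Let mG : measurable_fun setT G.
Proof.
apply/(measurable_restrictT _ mDT)/measurable_EFinP.
exact: (measurable_noise_pairing Vdim mU).
Qed.

Let G_le x s : (`|G (x, s)| <= B%:E * (1 + Fp (x, s)))%E.
Proof.
have [Dx|Dx] := pselect (D x); last first.
  rewrite GN// FpN// abse0 adde0 mule1 lee_fin.
  (* Off [D] only [0 <= B] is needed, and the value of [X] at any outcome is a point of [D] showing
     it. *)
  by rewrite (le_trans _ (DB (DX point))).
rewrite GE// FpE// -EFinD -EFinM lee_fin.
rewrite (le_trans (dual_norm_bound Vdim _ _))// mulrC.
have B0 : 0 <= B by rewrite (le_trans _ (DB Dx)).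
have u0 := dual_norm_ge0 Vdim (U x s).
rewrite ler_pM ?DB//; have [u1|u1] := leP (dual_norm (U x s)) 1.
  by rewrite (le_trans u1)// lerDl powR_ge0.
by rewrite (le_trans (le1r_powR (ltW u1) (ltW p1)))// lerDr.
Qed.

Let dominated_integrable (W : Om -> borel V * S) :
  measurable_fun setT W -> (\int[P]_w Fp (W w) <= (sigma `^ p)%:E)%E ->
  P.-integrable setT (G \o W).
Proof.
move=> mW iW; have mFW : measurable_fun setT (Fp \o W) by exact: measurableT_comp.
have iFW : P.-integrable setT (Fp \o W).
  apply/integrableP; split => //; under eq_integral do rewrite gee0_abs ?Fp_ge0//.
  by rewrite (le_lt_trans iW)// ltry.
apply: (@le_integrable _ _ _ _ _ _ _ (fun w => B%:E * (1 + Fp (W w)))%E) => //.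
- exact: measurableT_comp.
- by move=> w _; apply: le_trans (lee_abs _); rewrite /=; case: (W w) => x s; exact: G_le.
- apply: integrableZl => //; apply: integrableD => //.
  exact: finite_measure_integrable_cst.
Qed.

Lemma noise_pairing_integrable :
  P.-integrable setT (fun w => (U (X w) (Z w) (xs - X w) : R)%:E).
Proof.
rewrite (_ : (fun _ => _) = G \o (fun w => (X w, Z w))); last first.
  by apply/funext => w /=; rewrite GE.
apply: dominated_integrable; first exact: measurable_fun_pair.
by under eq_integral do rewrite FpE//; exact: noise_moment.
Qed.

Lemma noise_pairing_mean0 : (\int[P]_w (U (X w) (Z w) (xs - X w) : R)%:E = 0)%E.
Proof.
under eq_integral do rewrite -GE//.
apply: (integral_independent0 mX mZ mZ1 indep mG).
- have := noise_pairing_integrable.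
  by under [X in P.-integrable _ X]eq_fun do rewrite -GE//.
- move=> x; apply: (@dominated_integrable (fun w => (x, Z1 w))) => //.
  by apply: measurable_fun_pair.
- move=> x; have [Dx|Dx] := pselect (D x).
    by under eq_integral do rewrite GE//; have := Umean (xs - x) Dx; rewrite unlock.
  by under eq_integral do rewrite GN//; rewrite integral0.
Qed.

End NoiseMoments.

(** * Diameter, range of the regularizer and relative interior of a compact set *)

Section CompactSets.
Context (R : realType) (V : normedModType R) (X : set V).
Hypothesis cX : compact X.

Lemma compact_le_diameter x x' : X x -> X x' -> `|x' - x| <= diameter X.
Proof.
move=> Xx Xx'; apply: ub_le_sup; last by exists x, x'.
have [M XM] : exists M, forall z, X z -> `|z| <= M.
  have [M [_ XM]] := compact_bounded cX; exists (M + 1) => z Xz.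
  by apply: XM => //; rewrite ltrDl.
exists (M + M) => _ [z [z' [Xz Xz' ->]]].
by rewrite (le_trans (ler_normB _ _))// lerD// XM.
Qed.

(** Continuity on the compact set bounds [h] on both sides, so [sup] and [inf] in [range_width] are
    not default values. *)
Lemma range_width_ge (h : V -> \bar R) x x' :
  {within X, continuous h} -> (forall z, X z -> h z \is a fin_num) ->
  X x -> X x' -> fine (h x) - fine (h x') <= range_width X h.
Proof.
move=> ch hfin Xx Xx'.
have cf : {within X, continuous (fine \o h)}.
  apply/subspace_continuousP => z Xz; apply: fine_cvg; rewrite fineK ?hfin//.
  by move/subspace_continuousP : ch; apply.
have Xne : X !=set0 by exists x.
have [zM /set_mem _ zMP] := compact_EVT_max Xne cX cf.
have [zm /set_mem _ zmP] := compact_EVT_min Xne cX cf.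
rewrite /range_width lerB//.
  apply: ub_le_sup; last by exists x.
  by exists (fine (h zM)) => _ [z Xz <-]; apply: zMP; exact: mem_set.
apply: ge_inf; last by exists x'.
by exists (fine (h zm)) => _ [z Xz <-]; apply: zmP; exact: mem_set.
Qed.

(** The relative interior is the intersection of the closed set [X] with an open set. By steepness
    it is the set in which the queries lie. *)
Lemma measurable_relint : measurable (relint X : set (borel V)).
Proof.
pose W := interior [set z | affine_hull X z -> X z].
have -> : relint X = X `&` W by [].
apply: measurableI; last by apply: sub_sigma_algebra; exact: open_interior.
rewrite -[X in measurable X]setCK; apply: measurableC.
apply: sub_sigma_algebra; by apply: closed_openC; exact: compact_closed.
Qed.

End CompactSets.

(** * The iterates: measurability, independence and expected error *)

Section Process.
Context (R : realType) (V : normedModType R) (n : nat).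
Hypothesis Vdim : Vector.axiom n V.
Context (X : set V) (K L mu eta p sigma : R) (f h : V -> \bar R)
  (gf gh : V -> {linear V -> R^o}) (xs : V).
Context d (Om : measurableType d) (P : probability Om R).
Context dS (S : measurableType dS) (U : V -> S -> {linear V -> R^o})
  (seed : nat -> Om -> S) (x : nat -> Om -> V) (y : nat -> Om -> {linear V -> R^o}).
Hypotheses (X0 : X !=set0) (cX : compact X) (obj : objective X f gf)
  (reg : regularizer X K h gh) (hf : dom_subdiff h `<=` dom_subdiff f)
  (st : steep X h) (fmin : minimizer X f xs) (siid : iid P seed)
  (noise : stochastic_noise P (dom_subdiff h) (dom_subdiff f) U seed p sigma)
  (y1 : forall w, y 1%N w =1 (fun=> 0)) (run : sda X h gf U seed (fun=> eta) y x)
  (K0 : 0 < K) (eta0 : 0 < eta) (p12 : 1 < p <= 2).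

Let D0 := dom_subdiff h.

Lemma sda_subdiff t w : (0 < t)%N -> subdiff h (x t w) (eta \*: y t w).
Proof. by move=> t0; have [/(mirror_subdiff reg)] := run w t0. Qed.

Lemma sda_dom t w : (0 < t)%N -> D0 (x t w).
Proof. by move=> t0; exists (eta \*: y t w); exact: sda_subdiff. Qed.

Lemma sda_in t w : (0 < t)%N -> X (x t w).
Proof. by move=> t0; apply: (dom_subdiff_sub st); exact: sda_dom. Qed.

Let mD0 : measurable (D0 : set (borel V)).
Proof. by rewrite /D0 st; exact: measurable_relint. Qed.

(** By [mirror_lipschitz], the query moves little when the finitely many values [y t w (e i)] do, so
    [measurable_by_coordinates] applies over the past sigma-algebra. *)
Lemma past_measurable_query t : (0 < t)%N ->
  (forall v, measurable_fun setT
    ((fun w => y t w v) : g_sigma_algebraType (past seed t) -> R)) ->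
  measurable_fun setT (x t : g_sigma_algebraType (past seed t) -> borel V).
Proof.
move=> t0 my; have [e [c [M [M0 _ _ dM]]]] := dual_norm_coordinates Vdim.
apply: measurable_to_borel => W oW.
apply: (measurable_by_coordinates (T := g_sigma_algebraType (past seed t))
  (D := setT) (Y := fun i w => y t w (e i))) => //.
move=> w [_ Ww]; have : nbhs (x t w) W by exact: open_nbhs_nbhs.
move=> /nbhs_ballP[r /= r0 rW]; pose C := M * eta * n.+1%:R.
have C0 : 0 < C by rewrite !mulr_gt0.
exists (K * r / C) => [|w' _ yw']; first by rewrite divr_gt0// mulr_gt0.
split=> //; apply: rW; rewrite -ball_normE /= distrC -(ltr_pM2l K0).
have lip := mirror_lipschitz Vdim reg st (sda_subdiff w t0) (sda_subdiff w' t0).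
rewrite (le_lt_trans lip)// (le_lt_trans (dM _))//.
rewrite (@le_lt_trans _ _ (M * \sum_(i < n) eta * (K * r / C)))//.
  rewrite ler_wpM2l ?(ltW M0)// ler_sum// => i _ /=.
  have -> : eta *: y t w' (e i) - eta *: y t w (e i) =
    eta * (y t w' (e i) - y t w (e i)) by rewrite mulrBr.
  by rewrite normrM gtr0_norm// ler_pM2l// ltW.
rewrite sumr_const card_ord -mulr_natl.
have -> : M * (n%:R * (eta * (K * r / C))) = K * r * (M * eta * n%:R / C) by ring.
rewrite gtr_pMr ?mulr_gt0// ltr_pdivrMr// mul1r.
by rewrite /C ltr_pM2l ?mulr_gt0// ltr_nat.
Qed.

Lemma objective_gradient_continuous v z : D0 z -> forall e : R, 0 < e ->
  exists2 r : R, 0 < r & forall z', D0 z' -> `|z' - z| < r -> `|gf z' v - gf z v| < e.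
Proof.
move=> Dz e e0; case: obj => _ _ _ [_ gfc].
have e'0 : 0 < e / (`|v| + 1) by rewrite divr_gt0// ltr_wpDl.
have [r r0 rP] := dual_continuousP gfc (hf Dz) e'0.
exists r => // z' Dz' z'z; have {}rP := rP z' (hf Dz') z'z.
rewrite (le_lt_trans (dual_norm_bound Vdim (gf z' \- gf z) v))//.
rewrite (@le_lt_trans _ _ (e / (`|v| + 1) * `|v|))//.
  by rewrite ler_wpM2r// ltW.
by rewrite mulrAC -mulrA gtr_pMr// ltr_pdivrMr ?ltr_wpDl// mul1r ltrDl.
Qed.

(** Induction on time: the previous dual iterate makes the previous query measurable, and the update
    adds a function of that query and its seed. *)
Lemma past_measurable_dual t v : (0 < t)%N ->
  measurable_fun setT ((fun w => y t w v) : g_sigma_algebraType (past seed t) -> R).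
Proof.
case: t => // t _; elim: t v => [|t IH] v.
  rewrite (_ : (fun _ => _) = cst 0); first exact: measurable_cst.
  by apply/funext => w; rewrite y1.
(* [past seed t.+1] stops at seed [t]; the update uses seed [t.+1], which first belongs to
   [past seed t.+2]. *)
have widen d' (T : measurableType d') (g : Om -> T) :
    measurable_fun setT (g : g_sigma_algebraType (past seed t.+1) -> T) ->
    measurable_fun setT (g : g_sigma_algebraType (past seed t.+2) -> T).
  by move=> mg _ B mB; apply: (past_homo (leqnSn t.+1)); exact: mg.
have mx := widen _ _ _ (past_measurable_query (ltn0Sn t) IH).
rewrite (_ : (fun w => _) = fun w => y t.+1 w v - (gf (x t.+1 w) v +
    U (x t.+1 w) (seed t.+1 w) v)); last first.
  by apply/funext => w; have [_ ->] := run w (ltn0Sn t).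
apply: measurable_funB; first exact: widen.
apply: measurable_funD.
  apply: (measurable_continuous_on_comp (D := D0) (g := fun z => gf z v)) => //.
    exact: objective_gradient_continuous.
  by move=> w; exact: sda_dom.
case: noise => mU _ _ _.
apply: (@measurable_comp _ _ _ (g_sigma_algebraType (past seed t.+2))
  (borel V * S)%type R ((D0 : set (borel V)) `*` [set: S])
  (fun z => U z.1 z.2 v) setT (fun w => (x t.+1 w, seed t.+1 w))).
- exact: measurableX.
- by move=> _ [w _ <-]; split => //; exact: sda_dom.
- exact: mU.
- apply: measurable_fun_pair => //; apply: past_seed; exact: ltnSn.
Qed.

Lemma past_measurable_iterate t : (0 < t)%N ->
  measurable_fun setT (x t : g_sigma_algebraType (past seed t) -> borel V).
Proof. by move=> t0; apply: past_measurable_query => // v; exact: past_measurable_dual. Qed.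

Lemma measurable_iterate t : (0 < t)%N -> measurable_fun setT (x t : Om -> borel V).
Proof.
move=> t0 _ B mB; apply: (past_measurable siid (t := t)).
exact: (past_measurable_iterate t0).
Qed.

Lemma iterate_independent t (A : set (borel V)) (B : set S) : (0 < t)%N ->
  measurable A -> measurable B ->
  P (x t @^-1` A `&` seed t @^-1` B) = (P (x t @^-1` A) * P (seed 1%N @^-1` B))%E.
Proof.
move=> t0 mA mB; apply: (past_independent siid) => //.
by rewrite -[X in <<s _ >> X]setTI; exact: (past_measurable_iterate t0).
Qed.

Hypotheses (sc : rel_strongly_convex X h gh f gf mu) (sm : rel_smooth X h gh f gf L)
  (etaL : eta * L <= 1 / 2) (etamu : eta * mu <= 1).

Let q := 1 - eta * mu.
Let c := K^-1 + diameter X.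
Let xi s w := U (x s w) (seed s w) (xs - x s w) : R.
Let N s w := dual_norm (U (x s w) (seed s w)) `^ p.

Let q0 : 0 <= q. Proof. by rewrite subr_ge0. Qed.

Let c0 : 0 <= c.
Proof.
have [z Xz] := X0; rewrite addr_ge0 ?invr_ge0 ?(ltW K0)//.
by apply: le_trans (compact_le_diameter cX Xz Xz).
Qed.

Lemma sda_path_bound t w : K / 2 * `|x t.+1 w - xs| ^+ 2 <=
  q ^+ t * range_width X h +
  \sum_(1 <= s < t.+1) q ^+ (t - s) * (eta * xi s w + c * eta `^ p * N s w).
Proof.
have [Xxs _] := fmin.
pose B t := fine (h xs) - fine (h (x t w)) - gh (x t w) (xs - x t w).
have BK : K / 2 * `|x t.+1 w - xs| ^+ 2 <= B t.+1.
  by rewrite distrC; apply: (bregman_lower_bound Vdim reg st) => //; exact: sda_dom.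
apply: (le_trans BK).
have rec s : (0 < s)%N -> B s.+1 <= q * B s + (eta * xi s w + c * eta `^ p * N s w).
  move=> s0; have [_ ffin _ _] := obj.
  rewrite -[_ * N s w]mulrA -powRM ?(ltW eta0) ?(dual_norm_ge0 Vdim)//.
  have diam : `|x s.+1 w - x s w| <= diameter X.
    by apply: compact_le_diameter => //; exact: sda_in.
  have step := sda_descent Vdim reg st ffin sc sm fmin K0 p12 eta0 etaL diam.
  apply: (step (U (x s w) (seed s w)) (eta \*: y s w) (eta \*: y s.+1 w)).
  - exact: sda_subdiff.
  - exact: sda_subdiff.
  - by move=> v; have [_ yE] := run w s0; rewrite /= yE /= [LHS]mulrBr.
rewrite (le_trans (linear_recursion_bound q0 rec t))// lerD2r ler_wpM2l ?exprn_ge0//.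
(* Since [y 1] vanishes, uniqueness of subgradients along [X] reduces the initial divergence to
   [h xs - h (x 1)]. *)
have Xx1 : X (x 1%N w) by exact: sda_in.
have yx1 := sda_subdiff w (ltn0Sn 0).
rewrite /B -(steep_subgradient_unique Vdim reg st yx1 Xxs) /= y1 scaler0 subr0.
case: (reg) => _ _ hc _ _; apply: range_width_ge => // z.
exact: (regularizer_fin_num reg).
Qed.

Let mx s : (0 < s)%N -> measurable_fun setT (x s : Om -> borel V).
Proof. exact: measurable_iterate. Qed.

Let mseed s : (0 < s)%N -> measurable_fun setT (seed s).
Proof. by case: siid => + _ _; apply. Qed.

Let noise_inst s : (0 < s)%N -> [/\ P.-integrable setT (fun w => (xi s w)%:E),
  (\int[P]_w (xi s w)%:E = 0)%E, P.-integrable setT (fun w => (N s w)%:E) &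
  (\int[P]_w (N s w)%:E <= (sigma `^ p)%:E)%E].
Proof.
move=> s0; have [mU _ Umean Umom] := noise; have [Xxs _] := fmin.
have p1 : 1 < p by case/andP: p12.
have ind := @iterate_independent s _ _ s0.
have mean z v : D0 z -> ('E_P[fun w => U z (seed 1%N w) v] = 0)%E.
  by move=> /hf; exact: Umean.
have mom z : D0 z ->
    ('E_P[fun w => (dual_norm (U z (seed 1%N w)) `^ p)%R] <= (sigma `^ p)%:E)%E.
  by move=> /hf; exact: Umom.
have dom w : D0 (x s w) by exact: sda_dom.
have diam z : D0 z -> `|xs - z| <= diameter X.
  by move=> Dz; apply: compact_le_diameter => //; exact: (dom_subdiff_sub st).
split.
- exact: (noise_pairing_integrable Vdim mD0 mU (mx s0) (mseed s0) (mseed (ltn0Sn 0))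
    dom ind p1 mom diam).
- exact: (noise_pairing_mean0 Vdim mD0 mU (mx s0) (mseed s0) (mseed (ltn0Sn 0))
    dom ind p1 mean mom diam).
- exact: (noise_moment_integrable Vdim mD0 mU (mx s0) (mseed s0) (mseed (ltn0Sn 0))
    dom ind mom).
- exact: (noise_moment Vdim mD0 mU (mx s0) (mseed s0) (mseed (ltn0Sn 0)) dom ind mom).
Qed.


(** Integrates [sda_path_bound]: the terms [xi] have mean zero, and the moment terms leave a
    geometric sum. *)
Lemma sda_expectation t : 0 < mu ->
  ('E_P[fun w => (`|x t.+1 w - xs| ^+ 2)%R] <=
   (2 / K * (q ^+ t * range_width X h +
             (K^-1 + diameter X) * eta `^ p * sigma `^ p / (eta * mu)))%:E)%E.
Proof.
move=> mu0; rewrite unlock.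
pose k := 2 / K; have k0 : 0 < k by rewrite divr_gt0.
(* Coefficients for the sum reindexed by [s = i.+1]; the factor [k] cancels the [K / 2] of the path
   bound. *)
pose a i := k * q ^+ (t - i.+1) * eta.
pose b i := k * q ^+ (t - i.+1) * (c * eta `^ p).
have kc0 : 0 <= c * eta `^ p by rewrite mulr_ge0 ?powR_ge0.
have b0 i : 0 <= b i.
  by apply: mulr_ge0 => //; apply: mulr_ge0; [exact: ltW|exact: exprn_ge0].
pose g i w := ((a i)%:E * (xi i.+1 w)%:E + (b i)%:E * (N i.+1 w)%:E)%E.
pose r w := ((k * (q ^+ t * range_width X h))%:E + \sum_(0 <= i < t) g i w)%E.
have ig i : P.-integrable setT (g i).
  have [i1 _ i2 _] := noise_inst (ltn0Sn i).
  by apply: (integrableD measurableT); exact: integrableZl.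
have ir : P.-integrable setT r.
  apply: (integrableD measurableT (finite_measure_integrable_cst _ _ measurableT)).
  exact: integrable_sum.
have gle i : (\int[P]_w g i w <= (b i * sigma `^ p)%:E)%E.
  have [i1 z1 i2 z2] := noise_inst (ltn0Sn i).
  rewrite /g integralD//=; try exact: integrableZl.
  by rewrite !integralZl// z1 mule0 add0e (EFinM (b i)) lee_wpmul2l// lee_fin.
have mnorm : measurable_fun setT (fun w => `|x t.+1 w - xs| ^+ 2).
  have mc : measurable_fun setT ((fun z => `|z - xs| ^+ 2) : borel V -> R).
    apply: measurable_continuous_borel => z.
    have cn : `|z' - xs| @[z' --> z] --> `|z - xs|.
      by apply: cvg_norm; apply: cvgB; [exact: cvg_id|exact: cvg_cst].
    exact: (cvgM cn cn).
  exact: (measurableT_comp mc (mx (ltn0Sn t))).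
apply: (@le_trans _ _ (\int[P]_w r w)%E).
  apply: ge0_le_integral => //.
  - by move/measurable_EFinP : mnorm; exact.
  - by have /integrableP[] := ir.
  move=> w _; rewrite /r /g.
  under eq_bigr do rewrite -!EFinM -EFinD.
  rewrite sumEFin -EFinD lee_fin.
  have := ler_wpM2l (ltW k0) (sda_path_bound t w).
  have kK : k * (K / 2) = 1 by rewrite /k; field; rewrite gt_eqF.
  rewrite [k * (K / 2 * _)]mulrA kK mul1r => /le_trans; apply.
  rewrite mulrDr lerD2l big_add1 /= mulr_sumr.
  rewrite le_eqVlt; apply/orP; left; apply/eqP; apply: eq_bigr => i _.
  by rewrite /a /b; ring.
rewrite integralD//=; last 2 first.
- exact: finite_measure_integrable_cst.
- exact: integrable_sum.
rewrite integral_cst// [X in (_ * X + _)%E](_ : _ = 1%E); last exact: probability_setT.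
rewrite mule1 integral_sum//.
rewrite [2 / K * (_ + _)]mulrDr [leRHS]EFinD leeD2l//.
apply: (@le_trans _ _ (\sum_(0 <= i < t) (b i * sigma `^ p)%:E)%E); first exact: lee_sum.
rewrite sumEFin lee_fin.
(* Multiplied by [1 - q = eta * mu], the sum telescopes to [1 - q ^+ t]. *)
have geom : \sum_(0 <= i < t) q ^+ (t - i.+1) <= (eta * mu)^-1.
  rewrite -[leRHS]mul1r ler_pdivlMr ?mulr_gt0// big_nat_rev /= add0n big_mkord.
  under eq_bigr => i _ do rewrite subnSK// subKn 1?ltnW//.
  have -> : eta * mu = - (q - 1) by rewrite /q; ring.
  by rewrite mulrN mulrC -subrX1 opprB gerBl exprn_ge0.
rewrite (_ : \sum_(0 <= i < t) _ = k * (c * eta `^ p) * sigma `^ p *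
  \sum_(0 <= i < t) q ^+ (t - i.+1)).
  rewrite -/k -/c (_ : k * (_ / _) = k * (c * eta `^ p) * sigma `^ p / (eta * mu)).
    by rewrite ler_wpM2l// mulr_ge0 ?powR_ge0// mulr_ge0// ltW.
  by rewrite !mulrA.
by rewrite mulr_sumr; apply: eq_bigr => i _; rewrite /b; ring.
Qed.

End Process.

(** * Choice of learning rate, time horizon and accuracy threshold *)

Section Rate.
Context (R : realType).

Lemma powRVK (r x : R) : r != 0 -> 0 <= x -> (x `^ r^-1) `^ r = x.
Proof. by move=> r0 x0; rewrite -powRrM mulVf// powRr1. Qed.

(** Uses [1 - u <= expR (- u)]. The iterate of index [t.+1] has contracted only [t] times; as
    [u <= 1], this costs at most the factor [expR 1]. *)
Lemma contraction_power_le (q u l : R) (t : nat) : 0 <= q <= 1 -> q = 1 - u ->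
  l <= u * t.+1%:R -> q ^+ t <= expR 1 * expR (- l).
Proof.
move=> /andP[q0 q1] qE lu; rewrite -expRD.
apply: (@le_trans _ _ (expR (- u) ^+ t)).
  by rewrite lerXn2r ?nnegrE ?expR_ge0// qE expR_ge1Dx.
rewrite -expRM_natl ler_expR; move: lu; rewrite -natr1; lra.
Qed.

(** One of the two factors [eps] pays for the constants; [|H| + 1] keeps the denominator positive
    for an arbitrary real [H]. *)
Lemma initial_term_le (K H eps a : R) : 0 < K -> 0 < eps ->
  0 <= a <= expR 1 * eps ^+ 2 -> eps <= K / (4 * expR 1 * (`|H| + 1)) ->
  2 / K * (a * H) <= eps / 2.
Proof.
move=> K0 eps0 /andP[a0 aE]; have H1 : 0 < `|H| + 1 by rewrite ltr_wpDl.
have e1 : 0 < expR (1 : R) by exact: expR_gt0.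
rewrite ler_pdivlMr ?mulr_gt0// => /(ler_wpM2l (ltW eps0)) epsK.
have aH : a * H <= expR 1 * eps ^+ 2 * (`|H| + 1).
  apply: (@le_trans _ _ (a * (`|H| + 1))).
    by rewrite ler_wpM2l// (le_trans (ler_norm _))// lerDl.
  by rewrite ler_wpM2r// ltW.
rewrite mulrAC ler_pdivrMr//; move: epsK aH; rewrite !mulrDr; lra.
Qed.

End Rate.
Theorem corollary1 (R : realType) (p mu L K H dX : R) :
  1 < p <= 2 -> 0 < mu -> 0 < K ->
  exists a C : R, [/\ 0 < a, 0 < C &
  forall sigma : R, 0 < sigma ->
  exists2 eps0 : R, 0 < eps0 < 1 &
  forall (n : nat) (V : normedModType R) (Vdim : Vector.axiom n V)
    (X : set V) (f h : V -> \bar R) (gf gh : V -> {linear V -> R^o}) (xs : V)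
    (d : measure_display) (Om : measurableType d) (P : probability Om R)
    (dS : measure_display) (S : measurableType dS)
    (U : V -> S -> {linear V -> R^o}) (seed : nat -> Om -> S)
    (x : nat -> Om -> V) (y : nat -> Om -> {linear V -> R^o}) (eps : R),
  X !=set0 -> compact X -> convex_set X -> diameter X = dX ->
  objective X f gf ->
  regularizer X K h gh -> range_width X h = H ->
  dom_subdiff h `<=` dom_subdiff f ->
  steep X h ->
  rel_strongly_convex X h gh f gf mu ->
  rel_smooth X h gh f gf L ->
  minimizer X f xs ->
  iid P seed ->
  stochastic_noise P (dom_subdiff h) (dom_subdiff f) U seed p sigma ->
  0 < eps <= eps0 ->
  (forall w, y 1%N w =1 (fun=> 0)) ->
  sda X h gf U seed (fun=> a * (eps / sigma `^ p) `^ (p - 1)^-1) y x ->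
  forall t : nat, (0 < t)%N ->
    C * (sigma `^ p / eps) `^ (p - 1)^-1 * ln (eps^-1) <= t%:R ->
    ('E_P[fun w => (`|x t w - xs| ^+ 2)%R] <= eps%:E)%E].
Proof.
move=> p12 mu0 K0; have /andP[p1 p2] := p12.
have p10 : 0 < p - 1 by rewrite subr_gt0.
have pn0 : p - 1 != 0 by rewrite gt_eqF.
(* The constants are fixed before [X] is, so the sign of [dX] is unknown here and the absolute value
   keeps [c] positive. *)
pose c := K^-1 + `|dX|.
have c0 : 0 < c by rewrite ltr_pwDl// invr_gt0.
(* Chosen so that the stationary noise term [2 / K * c * r * eps / mu] is exactly [eps / 2]. *)
pose r := K * mu / (4 * c).
have r0 : 0 < r by rewrite divr_gt0 ?mulr_gt0.
pose a := r `^ (p - 1)^-1.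
have a0 : 0 < a by exact: powR_gt0.
have aE : a `^ (p - 1) = r by rewrite powRVK// ltW.
(* The numerator 2 yields a contraction of order [eps ^+ 2] rather than [eps]. *)
exists a, (2 / (a * mu)); split => //; first by rewrite divr_gt0// mulr_gt0.
move=> sigma sigma0; have s0 : 0 < sigma `^ p by exact: powR_gt0.
(* Below this cap both [eta * L <= 1 / 2] and [eta * mu <= 1] hold; [e1] turns the cap into a
   condition on [eps], and [e2] serves the initial term. *)
pose eta0 := Num.min (2 * (`|L| + 1))^-1 mu^-1.
have eta00 : 0 < eta0.
  by rewrite lt_min !invr_gt0 mu0 andbT mulr_gt0// ltr_wpDl.
pose e1 := sigma `^ p * (eta0 / a) `^ (p - 1).
pose e2 := K / (4 * expR 1 * (`|H| + 1)).
have e10 : 0 < e1 by rewrite mulr_gt0// powR_gt0// divr_gt0.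
have e20 : 0 < e2 by rewrite divr_gt0// !mulr_gt0 ?expR_gt0// ltr_wpDl.
exists (Num.min (1 / 2) (Num.min e1 e2)).
  rewrite !lt_min e10 e20 !andbT gt_min; apply/andP; split; first lra.
  by apply/orP; left; lra.
move=> n V Vdim X f h gf gh xs d Om P dS S U seed x y eps X0 cX _ diamX obj reg
  widthX hf st sc sm fmin siid noise /andP[eps0]; rewrite !le_min => /and3P[_ epse1 epse2].
move=> y1; set eta := a * _ => run [//|t] _.
have w0 : 0 < (eps / sigma `^ p) `^ (p - 1)^-1 by rewrite powR_gt0// divr_gt0.
have eta_gt0 : 0 < eta by rewrite mulr_gt0.
have eta_le : eta <= eta0.
  rewrite /eta mulrC -ler_pdivlMr//.
  have -> : eta0 / a = ((eta0 / a) `^ (p - 1)) `^ (p - 1)^-1.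
    by rewrite -powRrM mulfV// powRr1// divr_ge0// ltW.
  apply: ge0_ler_powR.
  - by rewrite invr_ge0 ltW.
  - by rewrite nnegrE divr_ge0 ?powR_ge0// ltW.
  - by rewrite nnegrE powR_ge0.
  - rewrite (ler_pdivrMr _ _ s0) mulrC; exact: epse1.
have etaL : eta * L <= 1 / 2.
  have : eta * (2 * (`|L| + 1)) <= 1.
    by rewrite -ler_pdivlMr ?mulr_gt0 ?ltr_wpDl// mul1r (le_trans eta_le)// ge_min lexx.
  have := ler_wpM2l (ltW eta_gt0) (ler_norm L); lra.
have etamu : eta * mu <= 1.
  by rewrite -ler_pdivlMr// mul1r (le_trans eta_le)// ge_min lexx orbT.
(* By the choice of [a], the power [eta]^ (p - 1)[equals]r * eps / sigma [^ p], so [sigma]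
   cancels. *)
have etap : eta `^ p * sigma `^ p = eta * (r * eps).
  rewrite -(mulr_powRB1 (ltW eta_gt0)) ?(lt_trans ltr01)// -mulrA; congr (_ * _).
  rewrite powRM ?(ltW a0) ?(ltW w0)// aE powRVK//; last by rewrite divr_ge0// ltW.
  by rewrite -mulrA divfK// gt_eqF.
move=> tC.
have lt : 2 * ln eps^-1 <= eta * mu * t.+1%:R.
  have := ler_wpM2l (ltW (mulr_gt0 eta_gt0 mu0)) tC; apply: le_trans.
  have ww : (eps / sigma `^ p) `^ (p - 1)^-1 * (sigma `^ p / eps) `^ (p - 1)^-1 = 1.
    rewrite -powRM ?divr_ge0 ?(ltW eps0) ?(ltW s0)// mulrA divfK ?gt_eqF//.
    by rewrite mulfV ?gt_eqF// powR1.
  rewrite /eta le_eqVlt; apply/orP; left; apply/eqP.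
  transitivity (2 * ln eps^-1 * ((eps / sigma `^ p) `^ (p - 1)^-1 *
      (sigma `^ p / eps) `^ (p - 1)^-1)).
    by rewrite ww mulr1.
  by field; rewrite !gt_eqF.
have dX_ge0 : 0 <= dX.
  have [z Xz] := X0; rewrite -diamX (le_trans _ (compact_le_diameter cX Xz Xz))//.
have := sda_expectation Vdim X0 cX obj reg hf st fmin siid noise y1 run K0 eta_gt0 p12
  sc sm etaL etamu t mu0.
move/le_trans; apply; rewrite lee_fin diamX widthX.
clearbody eta; have emu0 : 0 < eta * mu by rewrite mulr_gt0.
have q01 : 0 <= 1 - eta * mu <= 1 by rewrite subr_ge0 etamu gerBl (ltW emu0).
have qt := contraction_power_le q01 erefl lt.
have {}qt : (1 - eta * mu) ^+ t <= expR 1 * eps ^+ 2.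
  have -> : eps ^+ 2 = expR (- (2 * ln eps^-1)).
    by rewrite lnV ?posrE// mulrN opprK expRM_natl lnK ?posrE.
  exact: qt.
have q01' : 0 <= (1 - eta * mu) ^+ t <= expR 1 * eps ^+ 2.
  by rewrite qt andbT exprn_ge0//; case/andP: q01.
have init := initial_term_le K0 eps0 q01' epse2.
rewrite mulrDr -[eps in leRHS](@divfK _ 2) ?pnatr_eq0// mulr_natr mulr2n lerD//.
rewrite -[_ * _ * sigma `^ p]mulrA etap.
rewrite le_eqVlt; apply/orP; left; apply/eqP.
rewrite -[dX]ger0_norm// -/c /r; field.
by rewrite !gt_eqF.
Qed.
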